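(* Let $n\ge 0$ be an integer and let $p(x)$ be a polynomial with real coefficients, of degree at most $n$, that satisfies $p(1)=1$. Then $$\max_{x\in[-1,1]}(1-x)\,p(x)^2\;\geq\;\frac{2}{(2n+1)^2},$$ with equality if and only if $p(x)=h_n(x)$.
   Context: $T_k$ denotes the $k$-th Chebyshev polynomial of the first kind, the unique polynomial of degree $k$ with $T_k(\cos\xi)=\cos(k\xi)$. The polynomial $h_n$ is defined by $$h_n(x)=\frac{1}{2n+1}\left(1+2\sum_{k=1}^{n}T_k(x)\right).$$ *)

(* Defs.v *)
From HB Require Import structures.
From mathcomp Require Import all_boot all_order all_algebra.
From mathcomp Require Import all_classical all_reals all_analysis.
Set Implicit Arguments.
Unset Strict Implicit.
Unset Printing Implicit Defensive.
Import Order.TTheory GRing.Theory Num.Theory.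
Local Open Scope classical_set_scope.
Local Open Scope ring_scope.

Definition is_chebyshev (R : realType) (k : nat) (T : {poly R}) : Prop :=
  size T = k.+1 /\ forall xi : R, T.[cos xi] = cos (k%:R * xi).

(* The default value 0 is never taken: see [chebyshevP] and
   [chebyshev_unique]. *)
Definition chebyshev (R : realType) (k : nat) : {poly R} :=
  xget 0 [set T | is_chebyshev k T].

Lemma chebyshev_exists (R : realType) (k : nat) :
  exists T : {poly R}, is_chebyshev k T.
Proof.
suff [T [U [hT _]]] : exists T U : {poly R},
    is_chebyshev k T /\ is_chebyshev k.+1 U by exists T.
elim: k => [|k [T [U [[sT hT] [sU hU]]]]].
  exists 1, 'X; split; split.
  - by rewrite size_poly1.
  - by move=> xi; rewrite hornerC mul0r cos0.
  - by rewrite size_polyX.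
  - by move=> xi; rewrite hornerX mul1r.
exists U, (2%:R *: ('X * U) - T); split; split => //.
- have U0 : U != 0 by rewrite -size_poly_eq0 sU.
  have sXU : size (2%:R *: ('X * U) : {poly R}) = k.+3.
    by rewrite size_scale ?pnatr_eq0// mulrC size_mulX// sU.
  by rewrite size_polyDl sXU// size_polyN sT.
- move=> xi; rewrite hornerD hornerN hornerZ hornerM hornerX hT hU.
  have -> : k.+2%:R * xi = k.+1%:R * xi + xi by rewrite -natr1 mulrDl mul1r.
  have -> : k%:R * xi = k.+1%:R * xi - xi
    by rewrite -natr1 mulrDl mul1r addrK.
  rewrite cosB cosD mulr_natl mulr2n (mulrC (cos xi)).
  by rewrite opprD addrA addrK.
Qed.

Lemma chebyshev_unique (R : realType) (k : nat) (T U : {poly R}) :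
  is_chebyshev k T -> is_chebyshev k U -> T = U.
Proof.
move=> [_ hT] [_ hU]; apply/eqP; rewrite -subr_eq0; apply/negPn/negP => D0.
pose f (i : nat) : R := i.+1%:R^-1.
pose rs := [seq f i | i <- iota 0 (size (T - U))].
have rsr : all (root (T - U)) rs.
  apply/allP => _ /mapP[i _ ->]; rewrite rootE hornerD hornerN.
  have hi : -1 <= f i <= 1.
    apply/andP; split; last by rewrite invf_le1 ?ltr0n// ler1n.
    by apply: (@le_trans _ _ 0); rewrite ?lerN10// invr_ge0 ler0n.
  by rewrite -(acosK hi) hT hU subrr.
have urs : uniq rs.
  rewrite map_inj_uniq ?iota_uniq// => i j /invr_inj/eqP.
  by rewrite eqr_nat eqSS => /eqP.
by have := max_poly_roots D0 rsr urs; rewrite size_map size_iota ltnn.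
Qed.

Lemma chebyshevP (R : realType) (k : nat) : is_chebyshev k (chebyshev R k).
Proof. exact: (xgetPex 0 (chebyshev_exists R k)). Qed.

Definition hpoly (R : realType) (n : nat) : {poly R} :=
  (2 * n + 1)%:R^-1 *: (1 + 2%:R *: \sum_(1 <= k < n.+1) chebyshev R k).

Definition is_maximum (R : realType) (A : set R) (M : R) : Prop :=
  A M /\ ubound A M.

(* Main.v *)
Require Import Defs.
From HB Require Import structures.
From mathcomp Require Import all_boot all_order all_algebra.
From mathcomp Require Import all_classical all_reals all_analysis.
From mathcomp Require Import polyorder polyrcf.
From mathcomp Require Import ring lra.
Import Order.TTheory GRing.Theory Num.Theory.
Local Open Scope classical_set_scope.
Local Open Scope ring_scope.

(** The weight makes [hpoly R n] equioscillate, and equioscillation forces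
    minimality.  With [x = cos (2 t)] one has [1 - x = 2 sin^2 t], and the
    Dirichlet kernel formula gives
    [sin t * h(x) = sin ((2n+1) t) / (2n+1)] for [h = hpoly R n]
    ([sin_mul_hpoly]).  Hence [(1 - x) h(x)^2] never exceeds
    [2 / (2n+1)^2] on [-1, 1], and it reaches this bound at the [n+1] points
    [node R n j] where [(2n+1) t = pi/2 + j pi]; at these points [h] has the
    sign of [(-1)^j].

    Let [p] have degree at most [n], [p(1) = 1], and suppose that
    [(1 - x) p(x)^2 <= 2 / (2n+1)^2] holds at the nodes.  Then [|p| <= |h|]
    there, so [h - p] has, in the weak sense, the alternating signs of [h] on
    the nodes.  Since [p - h] also vanishes at [1], which lies to the right of
    all nodes, it alternates weakly on [n+2] points although its degree is at
    most [n]; [weakly_alternating_poly_eq0] then gives [p = h]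
    ([hpoly_minimal]).

    Both claims of the theorem follow: a maximum at most [2 / (2n+1)^2]
    forces [p = h], and for [p = h] the maximum is exactly that number. *)

(** * Weakly alternating polynomials *)

(** A nonzero polynomial of degree less than [m] has too few zeros to change
    sign along [m.+1] points.  Counting zeros is delicate with weak
    inequalities, where one zero can serve two neighbouring intervals; the
    induction goes through the derivative instead.  On each of the disjoint
    open intervals between neighbouring points, the mean value theorem yields
    a point where the derivative has the weak sign of the slope, so the
    derivative alternates on one point fewer.  Once it vanishes, the
    polynomial is a constant that is both nonnegative and nonpositive. *)
Lemma weakly_alternating_poly_eq0 (R : rcfType) (m : nat) (q : {poly R})
    (x : nat -> R) :
  (size q <= m)%N ->
  (forall i, (i < m)%N -> x i.+1 < x i) ->
  (forall i, (i <= m)%N -> 0 <= (-1) ^+ i * q.[x i]) ->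
  q = 0.
Proof.
elim: m q x => [|m IHm] q x sq x_decr q_sign.
  by apply/eqP; rewrite -size_poly_leq0.
have slope i : {xi | (i < m.+1)%N ->
    [/\ x i.+1 < xi, xi < x i &
        q.[x i] - q.[x i.+1] = q^`().[xi] * (x i - x i.+1)]}.
  have [im|_] := boolP (i < m.+1)%N; last by exists 0.
  have [xi xi_in dq] := poly_mvt q (x_decr i im).
  by exists xi => _; move: xi_in; rewrite in_itv/= => /andP[].
pose xi i := sval (slope i).
have xiP i := svalP (slope i) : (i < m.+1)%N -> _.
have q'0 : q^`() = 0.
  apply: (IHm _ xi) => [|i im|i im].
  - by rewrite size_deriv -subn1 leq_subLR add1n.
  - have [lt_xi _ _] := xiP _ (leqW im).
    by have [_ /lt_trans-> //] := xiP i.+1 im.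
  - have [_ _ dq] := xiP i im.
    have dx_gt0 : 0 < x i - x i.+1 by rewrite subr_gt0 x_decr.
    rewrite -(pmulr_lge0 _ dx_gt0) -mulrA -dq.
    have := q_sign i (leqW im); have := q_sign i.+1 im.
    rewrite exprS; lra.
have {sq} sq : (size q <= 1)%N.
  have := congr1 (fun r : {poly R} => size r) q'0.
  rewrite size_poly0 size_deriv.
  by case: (size q) => [|[]].
have := q_sign 0%N isT; have := q_sign 1%N isT.
rewrite (size1_polyC sq) !hornerC expr0 expr1 => c_le0 c_ge0.
by congr _%:P; lra.
Qed.

(** * The extremal polynomial *)

(** The sum telescopes: [2 sin t cos (2kt)] is the difference of
    [sin ((2k+1)t)] and [sin ((2k-1)t)].  Writing the angle as [2 t] makes the
    identity free of divisions, so it also covers [sin t = 0]. *)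
Lemma dirichlet_kernel (R : realType) (n : nat) (t : R) :
  sin t * (1 + 2%:R * \sum_(1 <= k < n.+1) cos (k%:R * (t *+ 2))) =
  sin ((2 * n + 1)%:R * t).
Proof.
elim: n => [|n IHn]; first by rewrite big_geq// mulr0 addr0 mulr1 muln0 mul1r.
rewrite big_nat_recr//= [2%:R * (_ + _)]mulrDr addrA mulrDr IHn.
have -> : (2 * n + 1)%:R * t = n.+1%:R * (t *+ 2) - t.
  by rewrite natrD natrM -natr1; ring.
have -> : (2 * n.+1 + 1)%:R * t = n.+1%:R * (t *+ 2) + t.
  by rewrite natrD natrM; ring.
rewrite sinB sinD; ring.
Qed.

Lemma sin_mul_hpoly (R : realType) (n : nat) (t : R) :
  sin t * (hpoly R n).[cos (t *+ 2)] =
  sin ((2 * n + 1)%:R * t) / (2 * n + 1)%:R.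
Proof.
rewrite /hpoly -dirichlet_kernel hornerZ hornerD hornerC hornerZ horner_sum.
under eq_bigr do rewrite (proj2 (chebyshevP R _)).
by rewrite mulrCA mulrC.
Qed.

Lemma size_hpoly (R : realType) (n : nat) : (size (hpoly R n) <= n.+1)%N.
Proof.
apply: (leq_trans (size_scale_leq _ _)).
apply: (leq_trans (size_polyD _ _)).
rewrite geq_max size_poly1 /=.
apply: (leq_trans (size_scale_leq _ _)).
rewrite big_nat; apply: (big_ind (fun r : {poly R} => (size r <= n.+1)%N)).
- by rewrite size_poly0.
- move=> r s hr hs; apply: (leq_trans (size_polyD _ _)).
  by rewrite geq_max hr.
- by move=> k /andP[_ kn]; rewrite (proj1 (chebyshevP R k)).
Qed.

Lemma hpoly_at1 (R : realType) (n : nat) : (hpoly R n).[1] = 1.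
Proof.
rewrite /hpoly hornerZ hornerD hornerC hornerZ horner_sum.
under eq_bigr => k _ do
  rewrite -[X in _.[X]]cos0 (proj2 (chebyshevP R _)) mulr0 cos0.
by rewrite sumr_const_nat subn1 -natrM nat1r addn1 mulVf.
Qed.

Lemma one_sub_cosM2 (R : realType) (t : R) :
  1 - cos (t *+ 2) = 2%:R * sin t ^+ 2.
Proof. by rewrite cos_mulr2n cos2sin2; ring. Qed.

Lemma weighted_hpoly_le (R : realType) (n : nat) (x : R) :
  -1 <= x <= 1 ->
  (1 - x) * (hpoly R n).[x] ^+ 2 <= 2%:R / (2 * n + 1)%:R ^+ 2.
Proof.
move=> /acosK <-; set t := acos x / 2%:R.
have -> : acos x = t *+ 2 by rewrite /t; field.
rewrite one_sub_cosM2 -mulrA -exprMn sin_mul_hpoly expr_div_n.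
by rewrite ler_pM2l ?ltr0n// ler_piMl ?invr_ge0 ?exprn_ge0//.
Qed.

(** * The equioscillation nodes *)

(** The parameter [t] of the node [cos (2 t)]: since
    [(2 n + 1) t = pi / 2 + j pi], the numerator [sin ((2 n + 1) t)] of the
    Dirichlet kernel is [(-1)^j]. *)
Definition half_node (R : realType) (n j : nat) : R :=
  (pi / 2%:R + pi *+ j) / (2 * n + 1)%:R.

Definition node (R : realType) (n j : nat) : R := cos (half_node R n j *+ 2).

Section nodes.
Variables (R : realType) (n : nat).
Local Notation half_node := (half_node R n).
Local Notation node := (node R n).

Let N_gt0 : 0 < (2 * n + 1)%:R :> R.
Proof. by rewrite ltr0n addn1. Qed.

Lemma half_node_gt0 j : 0 < half_node j.
Proof.
by rewrite divr_gt0// ltr_pwDl ?divr_gt0 ?pi_gt0// mulrn_wge0// pi_ge0.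
Qed.

Lemma half_node_le_pihalf j : (j <= n)%N -> half_node j <= pi / 2%:R.
Proof.
move=> jn; rewrite ler_pdivrMr// -[pi *+ j]mulr_natr natrD natrM.
have : pi * j%:R <= pi * n%:R :> R by rewrite ler_pM2l ?pi_gt0// ler_nat.
lra.
Qed.

Lemma half_node_lt j : half_node j < half_node j.+1.
Proof. by rewrite ltr_pM2r ?invr_gt0// ltrD2l mulrSr ltrDl pi_gt0. Qed.

Lemma sin_half_node_gt0 j : (j <= n)%N -> 0 < sin (half_node j).
Proof.
move=> jn; apply: sin_gt0_pi; rewrite half_node_gt0/=.
by apply: (le_lt_trans (half_node_le_pihalf _ jn)); have := pi_gt0 R; lra.
Qed.

Lemma sin_mul_hpoly_node j :
  sin (half_node j) * (hpoly R n).[node j] = (-1) ^+ j / (2 * n + 1)%:R.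
Proof.
rewrite sin_mul_hpoly [_ * half_node j]mulrC divfK ?gt_eqF//.
by rewrite (alternatingn (@sinDpi R)) sin_pihalf mulr1.
Qed.

Lemma weighted_hpoly_node j :
  (1 - node j) * (hpoly R n).[node j] ^+ 2 = 2%:R / (2 * n + 1)%:R ^+ 2.
Proof.
rewrite one_sub_cosM2 -mulrA -exprMn sin_mul_hpoly_node expr_div_n.
by rewrite sqrr_sign mul1r.
Qed.

Lemma node_itv j : -1 <= node j <= 1.
Proof. by rewrite cos_geN1 cos_le1. Qed.

Lemma double_half_node_itv j :
  (j <= n)%N -> half_node j *+ 2 \in `[0, pi].
Proof.
move=> jn; rewrite in_itv/=.
by have := half_node_gt0 j; have := half_node_le_pihalf _ jn; lra.
Qed.

Lemma node_lt1 j : (j <= n)%N -> node j < 1.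
Proof.
move=> jn; rewrite -cos0 ltr_cos ?double_half_node_itv//.
  by rewrite pmulrn_lgt0// half_node_gt0.
by rewrite in_itv/= lexx pi_ge0.
Qed.

Lemma node_decr j : (j < n)%N -> node j.+1 < node j.
Proof.
move=> jn; rewrite ltr_cos ?double_half_node_itv //; last exact: ltnW.
by rewrite ltrMn2r half_node_lt.
Qed.

(** The bound on [p] at the nodes says that [p] is dominated there by
    [hpoly R n] in absolute value, so the difference inherits the alternating
    signs of [hpoly R n]. *)
Lemma hpoly_minimal (p : {poly R}) :
  (size p <= n.+1)%N -> p.[1] = 1 ->
  (forall j, (j <= n)%N ->
    (1 - node j) * p.[node j] ^+ 2 <= 2%:R / (2 * n + 1)%:R ^+ 2) ->
  p = hpoly R n.
Proof.
move=> sp p1 p_le; apply/eqP; rewrite -subr_eq0; apply/eqP.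
(* The zero of [p - hpoly R n] at [1] has either weak sign, so [1] can be put
   in front of the nodes as the first point; this shifts the signs by one. *)
apply: (@weakly_alternating_poly_eq0 R n.+1 _
         (fun i => if i is j.+1 then node j else 1)).
- apply: (leq_trans (size_polyD _ _)).
  by rewrite geq_max size_polyN sp size_hpoly.
- by case=> [|j] jn; [exact: node_lt1 | exact: node_decr].
case=> [|j] jn; rewrite hornerD hornerN.
  by rewrite p1 hpoly_at1 subrr mulr0.
have s_gt0 := sin_half_node_gt0 _ jn.
rewrite -(pmulr_lge0 _ s_gt0).
(* The weight [1 - node j] is twice the square of [sin (half_node j)]. *)
have sp_le : `|sin (half_node j) * p.[node j]| <= (2 * n + 1)%:R^-1.
  rewrite -ler_sqr ?nnegrE// real_normK ?num_real//.
  have := p_le j jn; rewrite one_sub_cosM2 -mulrA ler_pM2l ?ltr0n//.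
  by rewrite exprVn exprMn.
have -> : (-1) ^+ j.+1 * (p.[node j] - (hpoly R n).[node j]) *
    sin (half_node j) =
    (-1) ^+ j * (sin (half_node j) * (hpoly R n).[node j]) -
    (-1) ^+ j * (sin (half_node j) * p.[node j]).
  by rewrite exprS; ring.
rewrite sin_mul_hpoly_node mulrA -expr2 sqrr_sign mul1r subr_ge0.
apply: (le_trans (ler_norm _)).
by rewrite normrM normrX normrN1 expr1n mul1r.
Qed.

End nodes.

(** * The extremal inequality *)

Section polynomial_maximum.
Import numFieldNormedType.Exports.

Lemma poly_attains_max (R : realType) (q : {poly R}) (a b : R) :
  a <= b ->
  exists2 c, c \in `[a, b] & forall x, x \in `[a, b] -> q.[x] <= q.[c].
Proof.
move=> ab; apply: (EVT_max ab).
by apply: continuous_subspaceT; exact: continuous_horner.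
Qed.

End polynomial_maximum.

Theorem theorem5 (R : realType) (n : nat) (p : {poly R})
    (degp : (size p <= n.+1)%N) (p1 : p.[1] = 1) :
  exists M : R,
    is_maximum [set (1 - x) * p.[x] ^+ 2 | x in `[(-1 : R), 1]] M /\
    2%:R / (2 * n + 1)%:R ^+ 2 <= M /\
    (M = 2%:R / (2 * n + 1)%:R ^+ 2 <-> p = hpoly R n).
Proof.
have le11 : -1 <= 1 :> R by lra.
have [c c_in] := poly_attains_max R ((1 - 'X) * p ^+ 2) _ _ le11.
have -> : horner ((1 - 'X) * p ^+ 2) = (fun x => (1 - x) * p.[x] ^+ 2).
  by apply/funext => x; rewrite !hornerE.
move=> c_max.
set M := (1 - c) * p.[c] ^+ 2 in c_max *.
have M_ge j : (1 - node R n j) * p.[node R n j] ^+ 2 <= M.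
  by apply: c_max; rewrite in_itv/= node_itv.
have M_le_eq : M <= 2%:R / (2 * n + 1)%:R ^+ 2 -> p = hpoly R n.
  move=> M_le; apply: hpoly_minimal => // j _.
  exact: le_trans (M_ge j) M_le.
have hM : p = hpoly R n -> M = 2%:R / (2 * n + 1)%:R ^+ 2.
  move=> ph; apply/eqP; rewrite eq_le; apply/andP; split.
    by rewrite /M ph weighted_hpoly_le//; move: c_in; rewrite in_itv.
  by rewrite -(weighted_hpoly_node R n 0) -ph M_ge.
exists M; split; [split|split].
- by exists c.
- by move=> _ [x x_in <-]; apply: c_max.
- rewrite leNgt; apply/negP => M_lt.
  by move: (M_lt); rewrite (hM (M_le_eq (ltW M_lt))) ltxx.
- by split=> [M_eq|/hM//]; apply: M_le_eq; rewrite M_eq.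
Qed.
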